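(* Let $G$ be a $(q+1,12)$-Moore graph with $q$ an odd prime power, $q\ge 9$. Then $$q^5-2q^4-4q^2+9q-18+\frac{42}{q+2}\le \chi_\rho (G)\le q^5+q^4-2q^3-q^2+4.$$
   Context: All graphs are finite, simple and undirected; $d(u,v)$ denotes the graph distance. A packing $k$-coloring of a graph $G$ is a function $\Gamma: V(G)\to\{1,2,\dots,k\}$ such that for every $i$, any two distinct vertices of color $i$ are at distance at least $i+1$. The packing chromatic number $\chi_\rho(G)$ is the smallest integer $k$ for which $G$ has a packing $k$-coloring. A $(k,g)$-graph is a $k$-regular graph of girth $g$. For $g$ even and $k\ge 3$, a $(k,g)$-Moore graph is a $(k,g)$-graph with exactly $n_0(k,g)=\frac{2(k-1)^{g/2}-2}{k-2}$ vertices, the minimum possible. In particular a $(q+1,12)$-Moore graph has $2(q+1)(q^4+q^2+1)$ vertices; it is the point-line incidence graph of a symmetric generalized $6$-gon (generalized hexagon) of order $q$. *)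

(* Defs.v *)
From mathcomp Require Import all_boot all_order all_algebra.
Set Implicit Arguments.
Unset Strict Implicit.
Unset Printing Implicit Defensive.

Import GRing.Theory.

Record sgraph := SGraph {
  vertex :> finType;
  adj : rel vertex;
  adj_sym : symmetric adj;
  adj_irr : irreflexive adj
}.

Definition walk (G : sgraph) (u v : G) (n : nat) : bool :=
  [exists p : n.-tuple G, path (@adj G) u p && (last u p == v)].

Lemma connect_walk (G : sgraph) (u v : G) :
  connect (@adj G) u v -> exists n, walk u v n.
Proof.
case/connectP=> p pth ->; exists (size p).
by apply/existsP; exists (in_tuple p); rewrite pth eqxx.
Qed.

(* [None] is the infinite distance between different components. *)
Definition gdist (G : sgraph) (u v : G) : option nat :=
  match boolP (connect (@adj G) u v) with
  | AltTrue uv => Some (ex_minn (connect_walk uv))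
  | AltFalse _ => None
  end.

Definition dist_ge (d : option nat) (m : nat) : bool :=
  if d is Some n then m <= n else true.

(* The ordinal [i : 'I_k] stands for the colour [i.+1] of {1, ..., k}. *)
Definition colour (k : nat) (i : 'I_k) : nat := i.+1.

Definition packing_coloring (G : sgraph) (k : nat) (c : {ffun G -> 'I_k}) :
    bool :=
  [forall u : G, forall v : G, (u != v) && (c u == c v) ==>
     dist_ge (gdist u v) (colour (c u)).+1].

Definition packing_colorable (G : sgraph) (k : nat) : bool :=
  [exists c : {ffun G -> 'I_k}, packing_coloring c].

Lemma ex_packing_colorable (G : sgraph) : exists k, packing_colorable G k.
Proof.
exists #|G|; apply/existsP; exists [ffun u => enum_rank u].
apply/forallP=> u; apply/forallP=> v; apply/implyP; rewrite !ffunE.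
by case/andP=> /negP neq_uv /eqP/enum_rank_inj/eqP.
Qed.

Definition packing_chromatic (G : sgraph) : nat :=
  ex_minn (ex_packing_colorable G).

Definition regular (G : sgraph) (k : nat) : Prop :=
  forall u : G, #|[set v : G | adj u v]| = k.

(* The size condition excludes the degenerate closed walk u, v, u, which
   [ucycle] accepts. *)
Definition simple_cycle (G : sgraph) (c : seq G) : Prop :=
  ucycle (@adj G) c /\ 3 <= size c.

Definition has_girth (G : sgraph) (g : nat) : Prop :=
  (exists2 c : seq G, simple_cycle c & size c = g) /\
  (forall c : seq G, simple_cycle c -> g <= size c).

Definition kg_graph (k g : nat) (G : sgraph) : Prop :=
  regular G k /\ has_girth G g.

Definition moore_bound (k g : nat) : rat :=
  ((2 * (k%:R - 1) ^+ g./2 - 2) / (k%:R - 2))%R.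

Definition moore_graph (k g : nat) (G : sgraph) : Prop :=
  [/\ 3 <= k, ~~ odd g, kg_graph k g G & (#|G|%:R = moore_bound k g)%R].

Definition prime_power (q : nat) : Prop :=
  exists p a : nat, [/\ prime p, 0 < a & q = p ^ a].

(* Main.v *)
(* A Moore graph of girth 12 is the incidence graph of a generalized hexagon:
   any two vertices are at distance at most 6, and it is bipartite with classes
   of size N = q^5 + ... + 1.

   Lower bound.  Colours above 5 occur at most once.  The colour classes 2 and 4
   have disjoint balls of radius 1 and 2, and the classes 1, 3, 5 have disjoint
   families of edges within distance 0, 1, 2.  Class 1 has fewer than N vertices
   unless it is a vertex cover; then the stars of class 2 are disjoint inside
   class 1, so class 2 is small.  This saves the 1 by which the five separate
   bounds fall short of the claim.

   Upper bound.  Give colour 1 to one bipartition class P'.  In the other class P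
   two vertices are at distance 2 (collinear) or at least 4, so colours 2 and 3 can
   be given to any two disjoint sets of pairwise non-collinear vertices.  A
   maximum such set in A <= P has at least 2|A| / (q^2 + 2q + 2) vertices by a local
   exchange argument, hence two disjoint ones of size (3q^3 + 2q^2 + q) / 2 exist.
   All remaining vertices of P get distinct colours. *)
Require Import Defs.
From mathcomp Require Import all_boot all_order all_algebra.
From mathcomp Require Import zify ring lra.
Import Order.TTheory GRing.Theory Num.Theory.
Set Implicit Arguments.
Unset Strict Implicit.
Unset Printing Implicit Defensive.

(** * Non-backtracking walks in graphs of large girth *)

Definition girth_ge (G : sgraph) (g : nat) : Prop :=
  forall c : seq G, simple_cycle c -> g <= size c.

(* Non-backtracking walks from [u] whose first step avoids [x]; by
   irreflexivity [x = u] imposes no condition on the first step. *)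
Fixpoint nbwalk (G : sgraph) (x u : G) (p : seq G) : bool :=
  if p is a :: p' then [&& adj u a, a != x & nbwalk u a p'] else true.

Lemma nbwalk_path (G : sgraph) (x u : G) p : nbwalk x u p -> path (@adj G) u p.
Proof. by elim: p x u => //= a p IH x u /and3P[-> _ /IH ->]. Qed.

Lemma nbwalk_weak (G : sgraph) (x u : G) p : nbwalk x u p -> nbwalk u u p.
Proof.
case: p => //= a p /and3P[ua _ ->]; rewrite ua andbT /=.
by apply/eqP=> eau; rewrite eau adj_irr in ua.
Qed.

(** The walk runs back along [s] to [u] and then along [t]. It does not turn round at [u], since [s]
    does not start with [x] while [t] is empty or does. *)
Lemma nbwalk_splice (G : sgraph) (x u : G) s t :
  nbwalk x u s -> nbwalk u u t -> head x t = x ->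
  nbwalk (last u s) (last u s) (rev (belast u s) ++ t).
Proof.
elim: s x u t => //= a s IH x u t /and3P[ua ax nbs] nbt hd.
rewrite rev_cons cat_rcons; apply: (IH u a (u :: t)) => //=.
rewrite adj_sym ua /=; apply/andP; split.
  by apply/eqP=> eau; rewrite eau adj_irr in ua.
case: t nbt hd => //= b t /and3P[-> _ ->] ->.
by rewrite eq_sym ax.
Qed.

(** By induction only the start can recur, and its recurrence would close a simple cycle of length
    at most [size p]. *)
Lemma nbwalk_uniq (G : sgraph) g (u : G) p :
  girth_ge G g -> nbwalk u u p -> size p < g -> uniq (u :: p).
Proof.
move=> gG; elim: p u => [//|a p IH] u /= /and3P[ua _ nbp] ltp.
have /= ap_uniq := IH a (nbwalk_weak nbp) (ltnW ltp).
rewrite ap_uniq andbT inE negb_or; apply/andP; split.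
  by apply/eqP=> eau; rewrite eau adj_irr in ua.
apply/negP=> /splitPr def_p; case: p / def_p => p1 p2 in IH nbp ltp ap_uniq *.
suff: g <= size (u :: a :: p1).
  by move: ltp; rewrite size_cat /=; lia.
apply: gG; split; last first.
  (* Were [p1] empty, the second step would go straight back to [u]; hence the cycle has length at
     least 3. *)
  by case: p1 {IH ltp ap_uniq} nbp => //=; rewrite eqxx andbF.
have /= := nbwalk_path nbp; rewrite cat_path /= => /and3P[pth1 lst _].
rewrite /ucycle /= ua rcons_path pth1 lst /=.
move: ap_uniq; rewrite mem_cat cat_uniq inE /= !negb_or.
case/andP=> /and3P[-> nau _] /and3P[-> /andP[-> _] _].
by rewrite eq_sym nau.
Qed.

Lemma nbwalk_closed (G : sgraph) g (u : G) p :
  girth_ge G g -> nbwalk u u p -> size p < g -> last u p = u -> p = [::].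
Proof.
move=> gG nbp ltp lp; have := nbwalk_uniq gG nbp ltp.
by case: p lp nbp ltp => //= a p lp _ _; rewrite -{1}lp mem_last.
Qed.

(** Once a common prefix is stripped, one walk reversed and followed by the other is a closed
    non-backtracking walk shorter than [g], hence empty. *)
Lemma nbwalk_inj (G : sgraph) g (u : G) p p' :
  girth_ge G g -> size p + size p' < g -> nbwalk u u p -> nbwalk u u p' ->
  last u p = last u p' -> p = p'.
Proof.
move=> gG; elim: p u p' => [|a p IH] u p' ltp nbp nbp' lpp'.
  by rewrite (nbwalk_closed gG nbp').
case: p' => [|b p'] in ltp nbp' lpp' *.
  by apply: (nbwalk_closed gG nbp) => //; rewrite -(addn0 (size _)).
have [ab|nab] := eqVneq a b.
  case/and3P: nbp nbp' => _ _ nbp /and3P[_ _ nbp']; subst b.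
  congr (a :: _); apply: (IH a) => //; last 2 first.
  - exact: nbwalk_weak nbp.
  - exact: nbwalk_weak nbp'.
  by move: ltp => /=; lia.
have nbs : nbwalk b u (a :: p) by move: nbp; rewrite /= nab => /and3P[-> _ ->].
have := nbwalk_splice nbs nbp' erefl; move/(nbwalk_closed gG).
rewrite /= in lpp' ltp *; rewrite size_cat size_rev /= size_belast last_cat.
rewrite rev_cons last_rcons cat_rcons /= => H.
have: rev (belast a p) ++ [:: u, b & p'] = [::] by apply: H; [lia | done].
by case: (rev _).
Qed.

(** Immediate reversals are deleted; each deletion removes two steps, so the end and the parity
    survive. *)
Lemma walk_reduce (G : sgraph) (u : G) p :
  path (@adj G) u p ->
  exists p', [/\ nbwalk u u p', last u p' = last u p, size p' <= size p
    & odd (size p') = odd (size p)].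
Proof.
elim: p u => [|a p IH] u /=; first by exists [::].
case/andP=> ua /IH[p' [nbp' lp' sp' op']].
have nau : a != u by apply/eqP=> eau; rewrite eau adj_irr in ua.
case: p' => [|b p'] in nbp' lp' sp' op' *.
  by exists [:: a]; rewrite /= ua nau -op'.
have [bu|nbu] := eqVneq b u.
  exists p'; subst b; case/and3P: nbp' => _ _ /nbwalk_weak nbp'.
  split=> //; first by rewrite /= in sp'; lia.
  by rewrite -op' /= negbK.
exists [:: a, b & p']; split=> //; last by rewrite -op'.
by case/and3P: nbp' => ab _ nb; rewrite /= ua nau ab nbu.
Qed.

Lemma closed_walk_even (G : sgraph) g (u : G) p :
  girth_ge G g -> path (@adj G) u p -> last u p = u -> size p < g ->
  ~~ odd (size p).
Proof.
move=> gG /walk_reduce[p' [nbp' lp' sp' <-]] lp ltp.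
by rewrite (nbwalk_closed gG nbp') //; [lia | rewrite lp'].
Qed.

Lemma sumn_map_const (T : eqType) (f : T -> nat) c s :
  {in s, forall x, f x = c} -> sumn [seq f x | x <- s] = size s * c.
Proof.
by elim: s => //= x s IH fc; rewrite fc ?mem_head // IH // => y ys;
  apply: fc; rewrite inE ys orbT.
Qed.

(** * Counting non-backtracking walks *)

Fixpoint nbwalks (G : sgraph) (n : nat) (x u : G) : seq (seq G) :=
  if n is n'.+1 then
    [seq a :: p | a <- enum [pred a | adj u a && (a != x)], p <- nbwalks n' u a]
  else [:: [::]].

Lemma mem_nbwalks (G : sgraph) n (x u : G) p :
  (p \in nbwalks n x u) = nbwalk x u p && (size p == n).
Proof.
elim: n x u p => [|n IH] x u p /=.
  by rewrite inE; case: p => //= a p; rewrite andbF.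
apply/allpairsPdep/idP => [[a [p' [+ + ->]]]|].
  by rewrite mem_enum inE IH => /andP[/= -> ->] /andP[-> /eqP->] /=.
case: p => [|a p]; rewrite ?andbF //= => /andP[/and3P[ua ax nbp] /eqP[sp]].
by exists a, p; rewrite mem_enum inE ua ax IH nbp sp eqxx.
Qed.

Lemma nbwalks_uniq (G : sgraph) n (x u : G) : uniq (nbwalks n x u).
Proof.
elim: n x u => //= n IH x u; apply: allpairs_uniq_dep; first exact: enum_uniq.
  by move=> a _; exact: IH.
by move=> [a p] [b p'] _ _ /= [-> ->].
Qed.

Lemma size_nbwalks (G : sgraph) q n (x u : G) :
  regular G q.+1 -> adj x u -> size (nbwalks n x u) = q ^ n.
Proof.
move=> regG; elim: n x u => //= n IH x u xu.
rewrite size_allpairs_dep.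
rewrite (sumn_map_const (c := q ^ n)) => [|a]; last first.
  by rewrite mem_enum inE => /andP[ua _]; apply: IH.
rewrite expnS; congr (_ * _); rewrite -cardE.
rewrite (eq_card (B := [set v | adj u v] :\ x)) => [|a]; last first.
  by rewrite !inE andbC.
have := cardsD1 x [set v | adj u v].
by rewrite regG inE adj_sym xu => -[].
Qed.

Lemma size_nbwalksS (G : sgraph) q n (u : G) :
  regular G q.+1 -> size (nbwalks n.+1 u u) = q.+1 * q ^ n.
Proof.
move=> regG; rewrite size_allpairs_dep.
rewrite (sumn_map_const (c := q ^ n)) => [|a]; last first.
  by rewrite mem_enum inE => /andP[ua _]; apply: size_nbwalks.
congr (_ * _); rewrite -cardE -[RHS](regG u); apply: eq_card => a.
rewrite !inE; apply: andb_idr => ua.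
by apply/eqP=> eau; rewrite eau adj_irr in ua.
Qed.

(** * Walks of given length and families of short walks *)

Lemma walkP (G : sgraph) (u v : G) n :
  reflect (exists p, [/\ path (@adj G) u p, last u p = v & size p = n])
    (walk u v n).
Proof.
apply: (iffP existsP) => [[p /andP[pth /eqP lp]]|[p [pth lp /eqP sp]]].
  by exists p; rewrite size_tuple.
by exists (Tuple sp); rewrite /= pth lp eqxx.
Qed.

Lemma walk_cat (G : sgraph) (u v w : G) m n :
  walk u v m -> walk v w n -> walk u w (m + n).
Proof.
move=> /walkP[p [pp <- <-]] /walkP[p' [pp' <- <-]]; apply/walkP.
by exists (p ++ p'); rewrite cat_path last_cat size_cat pp pp'.
Qed.

Lemma walk_sym (G : sgraph) (u v : G) n : walk u v n = walk v u n.
Proof.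
suff H (x y : G) : walk x y n -> walk y x n by apply/idP/idP; exact: H.
move=> /walkP[p [pp <- <-]]; apply/walkP.
exists (rev (belast x p)); rewrite rev_path size_rev size_belast; split=> //.
  by rewrite (eq_path (e' := @adj G)) // => a b; rewrite adj_sym.
by case: p {pp} => //= a p; rewrite rev_cons last_rcons.
Qed.

Lemma walk1 (G : sgraph) (u v : G) : walk u v 1 = adj u v.
Proof.
apply/walkP/idP => [[[|a [|? ?]] [//=]]|uv]; first by rewrite andbT => ? <-.
by exists [:: v]; rewrite /= uv.
Qed.

Lemma walk0 (G : sgraph) (u v : G) : walk u v 0 = (u == v).
Proof.
by apply/walkP/eqP => [[[|? ?] [//]]|->]; exists [::].
Qed.

Lemma walk2 (G : sgraph) (u v : G) :
  walk u v 2 = [exists w, adj u w && adj w v].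
Proof.
apply/walkP/existsP => [[[|a [|b [|? ?]]] [//=]]|[w]].
  by case/and3P=> ua ab _ <- _; exists a; rewrite ua ab.
by case/andP=> uw wv; exists [:: w; v]; rewrite /= uw wv.
Qed.

Lemma nbwalk_walk (G : sgraph) (x u : G) p :
  nbwalk x u p -> walk u (last u p) (size p).
Proof. by move/nbwalk_path=> pp; apply/walkP; exists p. Qed.

Lemma walk_odd_closed (G : sgraph) g (u : G) n :
  girth_ge G g -> walk u u n -> n < g -> ~~ odd n.
Proof. by move=> gG /walkP[p [pp lp <-]]; exact: closed_walk_even gG pp lp. Qed.

Definition short_nbwalks (G : sgraph) (m n : nat) (x u : G) : seq (seq G) :=
  [seq p | i <- iota m n, p <- nbwalks i x u].

Lemma mem_short_nbwalks (G : sgraph) m n (x u : G) p :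
  (p \in short_nbwalks m n x u) = nbwalk x u p && (m <= size p < m + n).
Proof.
apply/allpairsPdep/andP => [[i [p' [+ + ->]]]|[nbp sp]].
  by rewrite mem_iota mem_nbwalks => im /andP[-> /eqP->].
by exists (size p), p; rewrite mem_iota mem_nbwalks nbp eqxx.
Qed.

Lemma short_nbwalks_uniq (G : sgraph) m n (x u : G) :
  uniq (short_nbwalks m n x u).
Proof.
apply: allpairs_uniq_dep; first exact: iota_uniq.
  by move=> i _; exact: nbwalks_uniq.
move=> [i p] [j p'] /allpairsPdep[i' [p1 [_ + e1]]].
move=> + /allpairsPdep[j' [p1' [_ + e2]]] /= e3.
case: e1 => ei ep; case: e2 => ej ep'; subst i' p1 j' p1' p'.
by rewrite !mem_nbwalks => /andP[_ /eqP <-] /andP[_ /eqP <-].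
Qed.

Lemma size_short_nbwalks (G : sgraph) m n (x u : G) :
  size (short_nbwalks m n x u) = \sum_(m <= i < m + n) size (nbwalks i x u).
Proof.
by rewrite size_allpairs_dep sumnE big_map /index_iota addKn.
Qed.

(** Common form of the counting arguments: each [s] owns [c] labels, and the pairs of a member and a
    label inject into [A]. *)
Lemma leq_card_family (I T : finType) (W : eqType) (S : {set I}) (A : {set T})
    (ws : I -> seq W) (h : I -> W -> T) (c : nat) :
  (forall s, s \in S -> uniq (ws s)) ->
  (forall s, s \in S -> size (ws s) = c) ->
  (forall s w, s \in S -> w \in ws s -> h s w \in A) ->
  (forall s s' w w', s \in S -> s' \in S -> w \in ws s -> w' \in ws s' ->
     h s w = h s' w' -> s = s' /\ w = w') ->
  #|S| * c <= #|A|.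
Proof.
move=> wsU wsc hA hI.
have sz : size [seq h s w | s <- enum S, w <- ws s] = #|S| * c.
  rewrite size_allpairs_dep (sumn_map_const (c := c)) -?cardE // => s.
  by rewrite mem_enum; apply: wsc.
rewrite -sz [X in _ <= X]cardE; apply: uniq_leq_size.
  apply: allpairs_uniq_dep; first exact: enum_uniq.
    by move=> s; rewrite mem_enum; exact: wsU.
  move=> [s w] [s' w'] /allpairsPdep[s1 [w1 [+ + e1]]].
  move=> + + /allpairsPdep[s2 [w2 [+ + e2]]] /= e3.
  case: e1 => ei ep; case: e2 => ej ep'; subst s1 s2 w1 w2.
  rewrite !mem_enum => sS ww sS' ww'.
  by have [-> ->] := hI _ _ _ _ sS sS' ww ww' e3.
move=> t /allpairsPdep[s [w [+ + ->]]].
by rewrite !mem_enum; exact: hA.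
Qed.

(** * Separated sets *)

(** Quantifying over walks makes the condition vacuous for vertices in different components, in
    agreement with infinite distance. *)
Definition separated (G : sgraph) (m : nat) (S : {set G}) : Prop :=
  forall u v n, u \in S -> v \in S -> u != v -> walk u v n -> m <= n.

(** Balls of radius [r] about the members are disjoint, and girth above [2r] makes each a tree,
    counted by its non-backtracking walks from the centre. *)
Lemma separated_ball (G : sgraph) q r (S : {set G}) :
  regular G q.+1 -> girth_ge G r.*2.+1 -> separated r.*2.+1 S ->
  #|S| * (q.+1 * (\sum_(0 <= i < r) q ^ i)).+1 <= #|G|.
Proof.
move=> regG gG sepS; rewrite -cardsT.
apply: (@leq_card_family _ _ _ S _ (fun s => short_nbwalks 0 r.+1 s s)
          (fun s p => last s p)) => [s _|s _|s p _ _|s s' p p' sS sS'].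
- exact: short_nbwalks_uniq.
- rewrite size_short_nbwalks add0n big_nat_recl //= big_distrr /=.
  by rewrite add1n; congr _.+1; apply: eq_big_nat => i _; exact: size_nbwalksS.
- by rewrite inE.
rewrite !mem_short_nbwalks !add0n => /andP[nbp sp] /andP[nbp' sp'] lpp'.
have lt_pp' : size p + size p' < r.*2.+1 by rewrite ltnS -addnn leq_add.
have [ess'|nss'] := eqVneq s s'.
  by subst s'; split=> //; apply: (nbwalk_inj gG lt_pp' nbp nbp' lpp').
have := walk_cat (nbwalk_walk nbp); rewrite lpp' => /(_ s' (size p')).
rewrite walk_sym => /(_ (nbwalk_walk nbp')) /(sepS _ _ _ sS sS' nss').
by rewrite leqNgt lt_pp'.
Qed.

Lemma card_darts (G : sgraph) k (A : {set G}) : regular G k ->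
  #|[set e : G * G | (e.1 \in A) && adj e.1 e.2]| = #|A| * k.
Proof.
move=> regG; rewrite -sum_nat_const -sum1dep_card.
rewrite -(pair_big_dep (mem A) (fun u v => adj u v) (fun _ _ => 1)) /=.
by apply: eq_bigr => u _; rewrite sum1dep_card regG.
Qed.

Lemma nbwalk_rconsl (G : sgraph) (x u : G) p a :
  nbwalk x u (rcons p a) -> nbwalk x u p.
Proof. by elim: p x u => //= b p IH x u /and3P[-> -> /IH]. Qed.

(* A separated set meets every edge-centred ball of radius [r] at most once, so
   the edges whose ball contains a given member form disjoint families. *)
Lemma separated_edge_ball (G : sgraph) q r (S : {set G}) :
  regular G q.+1 -> girth_ge G r.*2.+3 -> separated r.*2.+2 S ->
  #|S| * (2 * \sum_(0 <= i < r.+1) q ^ i) <= #|G|.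
Proof.
(* The factor [q+1] turns the number of vertices into the number of oriented edges. *)
move=> regG gG sepS; rewrite -(leq_pmul2r (ltn0Sn q)).
have := card_darts setT regG; rewrite cardsT => <-.
rewrite -mulnA.
(* A walk of length 1 to [r+1] is sent to its last edge; the flag [w.2] picks the orientation. *)
pose dart s (w : seq G * bool) := let e := (last s (belast s w.1), last s w.1) in
  if w.2 then e else (e.2, e.1).
apply: (@leq_card_family _ _ _ S _
  (fun s => [seq (p, b) | p <- short_nbwalks 1 r.+1 s s, b <- [:: true; false]])
  dart) => [s _|s _|s w _|s s' w w' sS sS'].
- by apply: allpairs_uniq; [exact: short_nbwalks_uniq | | move=> [? ?] []].
- rewrite size_allpairs size_short_nbwalks mulnC -mulnA; congr (_ * _).
  rewrite add1n big_add1 /= mulnC big_distrr /=.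
  by apply: eq_big_nat => i _; exact: size_nbwalksS.
- case/allpairsP=> -[p b] [/= + _ ->]; rewrite mem_short_nbwalks /dart.
  case/andP=> /nbwalk_path; case/lastP: p => // p a.
  rewrite rcons_path belast_rcons last_rcons !inE /= => /andP[_ pa] _.
  by case: b; rewrite /= ?pa // adj_sym pa.
move=> /allpairsP[[p b] [pW _ ->]] /allpairsP[[p' b'] [/= + _ ->]].
move: pW => /=.
rewrite !mem_short_nbwalks /dart.
case/lastP: p => [|p a]; first by rewrite andbF.
case/lastP: p' => [|p' a']; first by rewrite andbF.
rewrite !belast_rcons !last_rcons !size_rcons /=.
move=> /andP[nbp sp] /andP[nbp' sp'] ee.
have {sp sp'} le_pp' : size p + size p' <= r.*2.
  by rewrite -addnn leq_add // -ltnS -[_.+1]add1n.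
have wp := nbwalk_walk (nbwalk_rconsl nbp).
have := nbwalk_walk (nbwalk_rconsl nbp'); rewrite walk_sym => wp'.
have ww' := walk_cat wp.
(* A shared edge would join distinct members by a walk of length at most [2r+1]. *)
have [ess'|nss'] := eqVneq s s'; last first.
  suff [n nlt wn] : exists2 n, n <= r.*2.+1 & walk s s' n.
    by have := sepS _ _ _ sS sS' nss' wn; rewrite leqNgt ltnS nlt.
  have pa : adj (last s p) a.
    by have := nbwalk_path nbp; rewrite rcons_path => /andP[].
  case: b b' ee => [] [] /= [e1 e2].
  - by exists (size p + size p'); [exact: leqW | apply: ww'; rewrite e1].
  - exists (size p + (1 + size p')); first by rewrite addnCA add1n ltnS.
    by apply: ww'; apply: walk_cat wp'; rewrite walk1 -e2.
  - exists (size p + (1 + size p')); first by rewrite addnCA add1n ltnS.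
    by apply: ww'; apply: walk_cat wp'; rewrite walk1 -e1.
  - by exists (size p + size p'); [exact: leqW | apply: ww'; rewrite e2].
subst s'; split=> //.
have same c : a = a' -> (rcons p a, c) = (rcons p' a', c).
  move=> eaa'; congr (_, _); apply: (nbwalk_inj gG _ nbp nbp').
    by rewrite !size_rcons addSn addnS !(ltnS, leqW).
  by rewrite !last_rcons.
(* If the same edge were crossed in opposite directions, [p] would be one step longer than [p'] and
   conversely. *)
have swapped : last s p = a' -> a = last s p' -> False.
  move=> e1 e2.
  have E1 : p = rcons p' a'.
    apply: (nbwalk_inj gG _ (nbwalk_rconsl nbp) nbp').
      by rewrite size_rcons addnS !(ltnS, leqW).
    by rewrite last_rcons.
  have E2 : p' = rcons p a.
    apply: (nbwalk_inj gG _ (nbwalk_rconsl nbp') nbp).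
      by rewrite size_rcons addnC addSn !(ltnS, leqW).
    by rewrite last_rcons.
  by have := congr1 size E1; rewrite E2 !size_rcons; lia.
by case: b b' ee => [] [] /= [e1 e2]; try exact: same;
   case: swapped.
Qed.

(** * The edge-centred tree of a Moore graph of girth 12 *)

(** The non-backtracking walks of length at most 5 from either end of [xy], not starting along that
    edge, have distinct ends and are as many as the vertices. *)
Lemma moore12_cover (G : sgraph) q (x y v : G) :
  regular G q.+1 -> girth_ge G 12 -> #|G| = 2 * (\sum_(0 <= i < 6) q ^ i) ->
  adj x y -> exists2 n, n <= 5 & walk y v n || walk x v n.
Proof.
move=> regG gG nG xy.
have yx : adj y x by rewrite adj_sym.
have nxy : x != y by apply/eqP=> exy; rewrite exy adj_irr in xy.
pose ws (b : bool) := if b then short_nbwalks 0 6 x y else short_nbwalks 0 6 y x.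
pose h (b : bool) (p : seq G) := last (if b then y else x) p.
pose A := [set w | (w \in map (h true) (ws true)) ||
                   (w \in map (h false) (ws false))].
(* With the step to [x] put before [p'], both walks start at [y] and have total length at most 11.
   The girth makes them equal, yet [p] does not begin with [x]. *)
have cross p p' : p \in ws true -> p' \in ws false -> h true p <> h false p'.
  rewrite !mem_short_nbwalks !add0n => /andP[nbp sp] /andP[nbp' sp'] lpp'.
  have nbyp' : nbwalk y y (x :: p') by rewrite /= yx nxy.
  have E : p = x :: p'.
    apply: (nbwalk_inj gG _ (nbwalk_weak nbp) nbyp' lpp').
    by rewrite /= addnS !ltnS; exact: (@leq_add _ _ 5 5).
  by move: nbp; rewrite E /= eqxx andbF.
have : #|[set: bool]| * (\sum_(0 <= i < 6) q ^ i) <= #|A|.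
  apply: (@leq_card_family _ _ _ _ _ ws h) => [b _|b _|b p _ pW|b b' p p' _ _].
  - by case: b; exact: short_nbwalks_uniq.
  - by case: b; rewrite size_short_nbwalks; apply: eq_big_nat => i _;
      exact: size_nbwalks.
  - by rewrite inE; case: b pW => pW; rewrite map_f ?orbT.
  case: b b' => [] [] pW pW' e; last 1 first.
  - split=> //; move: pW pW'; rewrite !mem_short_nbwalks !add0n.
    move=> /andP[/nbwalk_weak nbp sp] /andP[/nbwalk_weak nbp' sp'].
    apply: (nbwalk_inj gG _ nbp nbp' e).
    by rewrite ltnS leqW //; exact: (@leq_add _ _ 5 5).
  - split=> //; move: pW pW'; rewrite !mem_short_nbwalks !add0n.
    move=> /andP[/nbwalk_weak nbp sp] /andP[/nbwalk_weak nbp' sp'].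
    apply: (nbwalk_inj gG _ nbp nbp' e).
    by rewrite ltnS leqW //; exact: (@leq_add _ _ 5 5).
  - by case: (cross _ _ pW pW' e).
  - by case: (cross _ _ pW' pW (esym e)).
rewrite cardsT card_bool -nG -cardsT => leA.
have AT : A = setT by apply/eqP; rewrite eqEcard subsetT.
have: v \in A by rewrite AT inE.
rewrite inE => /orP[] /mapP[p]; rewrite mem_short_nbwalks => /andP[nbp sp] ->;
  exists (size p) => //; by rewrite (nbwalk_walk nbp) ?orbT.
Qed.

Lemma regular_neighbour (G : sgraph) q (u : G) :
  regular G q.+1 -> exists y, adj u y.
Proof.
move/(_ u) => regu; have: 0 < #|[set v | adj u v]| by rewrite regu.
by case/card_gt0P=> y; rewrite inE; exists y.
Qed.

Lemma moore12_diameter (G : sgraph) q (u v : G) :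
  regular G q.+1 -> girth_ge G 12 -> #|G| = 2 * (\sum_(0 <= i < 6) q ^ i) ->
  exists2 n, n <= 6 & walk u v n.
Proof.
move=> regG gG nG; have [y uy] := regular_neighbour u regG.
have [n n5 /orP[wyv|wuv]] := moore12_cover v regG gG nG uy.
  by exists n.+1 => //; apply: (@walk_cat _ u y v 1); rewrite ?walk1.
by exists n => //; apply: leqW.
Qed.

(** * The bipartition *)

Definition independent (T : finType) (e : rel T) (S : {set T}) : Prop :=
  {in S &, forall u v, ~~ e u v}.

Lemma independent_separated (G : sgraph) (S : {set G}) :
  independent (@adj G) S -> separated 2 S.
Proof.
move=> indS u v [|[|//]] uS vS nuv; first by rewrite walk0 (negbTE nuv).
by rewrite walk1 (negbTE (indS _ _ uS vS)).
Qed.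

(** For an edge [xy], this is the side of [x]: an even number of steps from [x] or an odd number
    from [y]. *)
Definition edge_parity (G : sgraph) (x y : G) : {set G} :=
  [set v | [exists n : 'I_6, walk (if odd n then y else x) v n]].

Lemma edge_parity_independent (G : sgraph) (x y : G) :
  girth_ge G 12 -> adj x y -> independent (@adj G) (edge_parity x y).
Proof.
move=> gG xy u v; rewrite !inE => /existsP[[i /= i6] wu] /existsP[[j /= j6]].
rewrite walk_sym => wv; apply/negP; rewrite -walk1 => uv.
have /= w := walk_cat (walk_cat wu uv) wv.
have [eo|no] := eqVneq (odd i) (odd j).
  rewrite eo in w; suff: ~~ odd (i + 1 + j) by rewrite !oddD eo; case: (odd j).
  by apply: (walk_odd_closed gG w); lia.
have {}w : walk (if odd i then y else x) (if odd i then y else x) (i + 1 + j + 1).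
  apply: walk_cat w _; rewrite walk1; move: no.
  by case: (odd i) (odd j) => [] [] // _; rewrite // adj_sym.
suff: ~~ odd (i + 1 + j + 1).
  by rewrite !oddD; case: (odd i) (odd j) no => [] [].
(* Lengths of different parity cannot both be 5, so the closed walk has length at most 11. *)
by apply: (walk_odd_closed gG w); lia.
Qed.

Lemma edge_parity_cover (G : sgraph) q (x y : G) :
  regular G q.+1 -> girth_ge G 12 -> #|G| = 2 * (\sum_(0 <= i < 6) q ^ i) ->
  adj x y -> edge_parity x y :|: edge_parity y x = setT.
Proof.
move=> regG gG nG xy; apply/setP=> v; rewrite !inE.
have [n n5 w] := moore12_cover v regG gG nG xy; apply/orP.
by case/orP: w => w; case on: (odd n); [left|right|right|left];
  apply/existsP; exists (Ordinal (n5 : n < 6)); rewrite /= on.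
Qed.

(** Both sides of an edge are independent, so each has at most half of the vertices; as they cover
    the graph, equality holds. *)
Lemma moore12_bipartition (G : sgraph) q :
  regular G q.+1 -> girth_ge G 12 -> #|G| = 2 * (\sum_(0 <= i < 6) q ^ i) ->
  0 < #|G| ->
  exists P : {set G}, [/\ independent (@adj G) P, independent (@adj G) (~: P)
    & #|P| = \sum_(0 <= i < 6) q ^ i].
Proof.
move=> regG gG nG /card_gt0P[x _]; have [y xy] := regular_neighbour x regG.
have yx : adj y x by rewrite adj_sym.
have half (u v : G) : adj u v -> #|edge_parity u v| <= \sum_(0 <= i < 6) q ^ i.
  move=> uv; rewrite -(leq_pmul2l (isT : 0 < 2)) -nG mulnC.
  have g3 : girth_ge G 0.*2.+3 by move=> c /gG; apply: leq_trans.
  have := separated_edge_ball regG g3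
            (independent_separated (edge_parity_independent gG uv)).
  by rewrite big_nat1 expn0.
set P := edge_parity x y; set P' := edge_parity y x.
have PP' : P :|: P' = setT by exact: edge_parity_cover regG gG nG xy.
have sub : ~: P \subset P'.
  by apply/subsetP=> v; rewrite inE => vP; have := in_setT v;
    rewrite -PP' inE (negbTE vP).
exists P; split.
- exact: edge_parity_independent.
- by move=> u v /(subsetP sub) uP /(subsetP sub) vP;
    exact: (edge_parity_independent gG yx).
have := half _ _ xy; have := half _ _ yx; rewrite -/P -/P'.
have := subset_leq_card sub; have := cardsC P; rewrite nG; lia.
Qed.

(** * Partial distance-2 ovoids by local search *)

Lemma sum_bool_card (T : finType) (B : {set T}) (p : pred T) :
  \sum_(v in B) (p v : nat) = #|[set v in B | p v]|.
Proof. by rewrite -sum1dep_card [RHS]big_mkcondr. Qed.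

(* In an independent set [S] of maximum size, the vertices whose only neighbour
   in [S] is [s] form a clique: two non-adjacent ones could replace [s].  Every
   other vertex outside [S] has at least two neighbours in [S]. *)
Lemma large_independent (T : finType) (e : rel T) (A : {set T}) (D c : nat) :
  symmetric e -> irreflexive e ->
  {in A, forall s, #|[set v in A | e s v]| <= D} ->
  (forall s (B : {set T}), {in B, forall v, e s v} ->
     {in B &, forall u v, u != v -> e u v} -> #|B| <= c) ->
  exists S : {set T},
    [/\ S \subset A, independent e S & 2 * #|A| <= #|S| * (D + c + 2)].
Proof.
move=> e_sym eirr degD cliqueC.
pose ok (S : {set T}) :=
  (S \subset A) && [forall u in S, forall v in S, ~~ e u v].
have okP (S : {set T}) : reflect (S \subset A /\ independent e S) (ok S).
  apply: (iffP andP) => [[sub /forall_inP H]|[sub indS]]; split=> //.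
    by move=> u v uS; move: v; apply/forall_inP; apply: H.
  by apply/forall_inP=> u uS; apply/forall_inP=> v; apply: indS.
have ok0 : ok set0.
  by apply/okP; split; [exact: sub0set | move=> u v; rewrite inE].
case: (arg_maxnP (fun S : {set T} => #|S|) ok0) => S /okP[SA indS] maxS.
exists S; split=> //.
pose N v := [set s in S | e s v].
pose priv s := [set v in A :\: S | N v == [set s]].
(* Otherwise [v] could be added to [S]. *)
have N_gt0 v : v \in A :\: S -> 0 < #|N v|.
  rewrite inE => /andP[vS vA]; rewrite lt0n; apply: contraNN vS => /eqP/cards0_eq N0.
  have nev s : s \in S -> ~~ e s v.
    by move=> sS; have := in_set0 s; rewrite -N0 inE sS => /= ->.
  have: ok (v |: S).
    apply/okP; split; first by rewrite subUset sub1set vA.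
    move=> a b; rewrite !inE => /predU1P[->|aS] /predU1P[->|bS].
    - by rewrite eirr.
    - by rewrite e_sym nev.
    - exact: nev.
    - exact: indS.
  move/maxS; rewrite /= cardsU1; case: (v \in S) => //=.
  by rewrite add1n ltnn.
have privC s : s \in S -> #|priv s| <= c.
  move=> sS; have privN u : u \in priv s -> forall t, t \in S -> e t u = (t == s).
    rewrite inE => /andP[_ /eqP Nu] t tS.
    by have := in_set1 t s; rewrite -Nu inE tS /=.
  apply: (cliqueC s) => [v vs|u v us vs nuv]; first by rewrite (privN v).
  apply: contraT => neuv.
  have uAS : u \in A :\: S by move: us; rewrite inE => /andP[].
  have vAS : v \in A :\: S by move: vs; rewrite inE => /andP[].
  move: uAS vAS; rewrite !inE => /andP[uS uA] /andP[vS vA].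
  have nS w t : w \in priv s -> t \in S :\ s -> ~~ e t w.
    by move=> ws; rewrite !inE => /andP[ts tS]; rewrite (privN w).
  have: ok (u |: (v |: S :\ s)).
    apply/okP; split.
      by rewrite !subUset !sub1set uA vA (subset_trans (subsetDl _ _)).
    move=> a b; rewrite in_setU1 in_setU1 => /predU1P[->|/predU1P[->|aS]];
      rewrite in_setU1 in_setU1 => /predU1P[->|/predU1P[->|bS]];
      rewrite ?eirr ?neuv //.
    + by rewrite e_sym nS.
    + by rewrite e_sym.
    + by rewrite e_sym nS.
    + by rewrite nS.
    + by rewrite nS.
    + by move: aS bS; rewrite !inE => /andP[_ aS] /andP[_ bS]; apply: indS.
  move/maxS; rewrite /= !cardsU1 !inE negb_or nuv (negbTE uS) (negbTE vS) !andbF.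
  by rewrite (cardsD1 s S) sS /= !add1n ltnn.
have cardA : #|A| = #|S| + #|A :\: S|.
  by rewrite -(cardsID S A) (setIidPr SA).
suff : 2 * #|A :\: S| <= #|S| * (D + c) by rewrite cardA; nia.
rewrite mulnC -sum_nat_const.
(* A vertex with a single neighbour in [S] is counted once more as private, so every vertex outside
   [S] has weight at least 2. *)
have step1 v : v \in A :\: S -> 2 <= \sum_(s in S) (e s v + (v \in priv s)).
  move=> vAS; rewrite big_split /=.
  have -> : \sum_(s in S) e s v = #|N v|.
    exact: sum_bool_card.
  have := N_gt0 v vAS; rewrite leq_eqVlt => /predU1P[/esym/eqP|gt1]; last first.
    exact: leq_trans gt1 (leq_addr _ _).
  move/cards1P=> [s Ns]; rewrite Ns cards1.
  have sS : s \in S by have := set11 s; rewrite -Ns inE => /andP[].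
  by rewrite (bigD1 s sS) /= [v \in priv s]inE vAS Ns eqxx.
apply: (@leq_trans (\sum_(v in A :\: S) \sum_(s in S) (e s v + (v \in priv s)))).
  exact: leq_sum.
(* Seen from [s], the weight is at most [D] from its neighbours plus [c] from its private ones. *)
rewrite exchange_big /= -sum_nat_const; apply: leq_sum => s sS.
rewrite big_split /=; apply: leq_add.
  apply: leq_trans (degD s (subsetP SA s sS)).
  rewrite sum_bool_card; apply/subset_leq_card/subsetP=> v.
  by rewrite !inE => /andP[/andP[_ ->] ->].
apply: leq_trans (privC s sS); rewrite sum_bool_card.
by apply/subset_leq_card/subsetP=> v; rewrite inE => /andP[].
Qed.

Definition collinear (G : sgraph) : rel G :=
  fun u v => (u != v) && [exists w, adj u w && adj w v].
Arguments collinear : clear implicits.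

Lemma collinear_degree (G : sgraph) q (u : G) :
  regular G q.+1 -> #|[set v | collinear G u v]| <= q.+1 * q.
Proof.
move=> regG; have := size_nbwalksS 1 u regG; rewrite expn1 => <-.
rewrite -(size_map (last u)); apply: leq_trans (card_size _).
apply/subset_leq_card/subsetP=> v.
rewrite inE => /andP[nuv /existsP[w /andP[uw wv]]].
apply/mapP; exists [:: w; v] => //; rewrite mem_nbwalks /= uw wv (eq_sym v) nuv.
by rewrite !andbT; apply/eqP=> ewu; rewrite ewu adj_irr in uw.
Qed.

(** All of [B] is adjacent to the common neighbour [w] of [s] and one member [b], since a triangle
    of collinearities with distinct middle vertices gives a cycle of length at most 6. Besides [s],
    [w] has [q] neighbours. *)
Lemma collinear_clique (G : sgraph) q (s : G) (B : {set G}) :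
  regular G q.+1 -> girth_ge G 7 -> {in B, forall v, collinear G s v} ->
  {in B &, forall u v, u != v -> collinear G u v} -> #|B| <= q.
Proof.
move=> regG gG sB cB; have [->|[b bB]] := set_0Vmem B; first by rewrite cards0.
have /andP[nsb /existsP[w /andP[sw wb]]] := sB b bB.
have nadj (x y : G) : adj x y -> (x != y) * (y != x).
  move=> xy; have nxy : x != y by apply/eqP=> exy; rewrite exy adj_irr in xy.
  by rewrite [y == x]eq_sym nxy.
suff sub : B \subset [set v | adj w v] :\ s.
  apply: leq_trans (subset_leq_card sub) _.
  by have := cardsD1 s [set v | adj w v]; rewrite regG inE adj_sym sw => -[->].
apply/subsetP=> v vB; have /andP[nsv /existsP[w3 /andP[sw3 w3v]]] := sB v vB.
rewrite !inE (eq_sym v) nsv /=; have [<-//|nbv] := eqVneq b v.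
have /andP[_ /existsP[w2 /andP[bw2 w2v]]] := cB b v bB vB nbv.
have [<-//|nw2w] := eqVneq w2 w.
have nb3 : nbwalk s s [:: w3; v].
  by rewrite /= sw3 w3v (nadj _ _ sw3) (eq_sym v) nsv.
have nb : nbwalk s s [:: w; b; w2; v].
  by rewrite /= sw wb bw2 w2v (nadj _ _ sw) nw2w (eq_sym b) nsb (eq_sym v) nbv.
by have: [:: w; b; w2; v] = [:: w3; v] by apply: (nbwalk_inj gG _ nb nb3).
Qed.

Lemma collinear_sym (G : sgraph) : symmetric (collinear G).
Proof.
move=> u v; rewrite /collinear eq_sym; congr (_ && _).
by apply: eq_existsb => w; rewrite andbC ![adj _ w]adj_sym ![adj w _]adj_sym.
Qed.

Lemma collinear_irr (G : sgraph) : irreflexive (collinear G).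
Proof. by move=> u; rewrite /collinear eqxx. Qed.

(** Local search with [D = q(q+1)] and [c = q]; the set found is truncated to size [t]. *)
Lemma collinear_independent_card (G : sgraph) q (A : {set G}) t :
  regular G q.+1 -> girth_ge G 7 -> t * (q ^ 2 + 2 * q + 2) <= 2 * #|A| ->
  exists S : {set G}, [/\ S \subset A, independent (collinear G) S & #|S| = t].
Proof.
move=> regG gG leA.
have degA : {in A, forall s, #|[set v in A | collinear G s v]| <= q.+1 * q}.
  move=> s _; apply: leq_trans (collinear_degree s regG).
  by apply/subset_leq_card/subsetP=> v; rewrite !inE => /andP[].
have [S [SA indS leS]] := large_independent (@collinear_sym G) (@collinear_irr G)
  degA (fun s B => @collinear_clique G q s B regG gG).
have leT : t <= #|S|.
  have : t * (q ^ 2 + 2 * q + 2) <= #|S| * (q ^ 2 + 2 * q + 2).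
    apply: leq_trans leA (leq_trans leS _).
    by rewrite leq_mul2l; apply/orP; right; rewrite -mulnn; lia.
  by rewrite leq_pmul2r // addn2.
have sub : [set x in take t (enum S)] \subset S.
  by apply/subsetP=> x; rewrite inE => /mem_take; rewrite mem_enum.
exists [set x in take t (enum S)]; split.
- exact: subset_trans sub SA.
- by move=> u v /(subsetP sub) uS /(subsetP sub); apply: indS.
- rewrite cardsE (card_uniqP (take_uniq _ (enum_uniq _))) size_takel //.
  by rewrite -cardE.
Qed.

(** * Packing colourings *)

Lemma dist_geP (G : sgraph) (u v : G) m :
  reflect (forall n, walk u v n -> m <= n) (dist_ge (gdist u v) m).
Proof.
pose C := connect (@adj G) u v.
(* The [boolP] evidence inside [gdist] is generalised so that it can be analysed by cases. *)
suff H b (s : alt_spec C C b) : reflect (forall n, walk u v n -> m <= n)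
    (dist_ge (match s with AltTrue uv => Some (ex_minn (connect_walk uv))
                         | AltFalse _ => None end) m) by exact: H.
case: s => [uv|nuv] /=.
  case: ex_minnP => d wd min_d; apply: (iffP idP) => [md n /min_d|]; last exact.
  exact: leq_trans.
apply: ReflectT => n /walkP[p [pp lp _]]; case/negP: nuv.
by apply/connectP; exists p.
Qed.

(** Walks of length 1 and 3 change sides of the bipartition, and a walk of length 2 would make its
    ends collinear. *)
Lemma collinear_separated (G : sgraph) (P S : {set G}) :
  independent (@adj G) P -> independent (@adj G) (~: P) -> S \subset P ->
  independent (collinear G) S -> separated 4 S.
Proof.
move=> indP indC /subsetP SP indS u v n uS vS nuv.
have [uP vP] := (SP u uS, SP v vS).
have out a b : a \in P -> adj a b -> b \notin P.
  by move=> aP ab; apply/negP=> bP; have := indP a b aP bP; rewrite ab.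
case: n => [|[|[|[|//]]]]; first by rewrite walk0 (negbTE nuv).
- by rewrite walk1 (negbTE (indP _ _ uP vP)).
- by have := indS u v uS vS; rewrite /collinear nuv walk2 /= => /negbTE->.
move/walkP=> [[|a [|b [|c [|? ?]]]] [//=]].
move=> /and4P[ua ab bc _] ecv _; rewrite ecv in bc; have aP := out _ _ uP ua.
have bP : b \in P.
  by apply: contraT => bP; have := indC a b; rewrite !inE aP bP ab => /(_ isT isT).
by move: vS => /SP; rewrite (negbTE (out _ _ bP bc)).
Qed.

Lemma packing_chromatic_leq (G : sgraph) (P S1 S2 : {set G}) :
  independent (@adj G) P -> independent (@adj G) (~: P) ->
  S1 \subset P -> S2 \subset P :\: S1 ->
  independent (collinear G) S1 -> independent (collinear G) S2 ->
  packing_chromatic G <= #|P| - #|S1| - #|S2| + 3.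
Proof.
move=> indP indC S1P S2P ind1 ind2.
pose R := P :\: S1 :\: S2.
have -> : #|P| - #|S1| - #|S2| + 3 = #|R|.+3.
  by rewrite !cardsD (setIidPr S1P) (setIidPr S2P) addn3.
(* Values are zero-based: 0, 1, 2 stand for colours 1, 2, 3, and each vertex of [R] gets its own
   value from 3 on. *)
pose f v := if v \notin P then 0 else if v \in S1 then 1 else
  if v \in S2 then 2 else (index v (enum R)).+3.
have fP v : f v < #|R|.+3.
  rewrite /f; case: ifP => // /negbFE vP; do 2!case: ifP => // ?.
  by rewrite !ltnS cardE index_mem mem_enum !inE vP; apply/and3P; split=> //;
    apply/negbT.
suff col : packing_colorable G #|R|.+3.
  by rewrite /packing_chromatic; case: ex_minnP => m _; apply.
apply/existsP; exists [ffun v => inord (f v)].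
apply/forallP=> u; apply/forallP=> v; apply/implyP=> /andP[nuv].
rewrite !ffunE => /eqP/(congr1 val) /=; rewrite /colour !inordK // => fuv.
apply/dist_geP=> n; move: fuv; rewrite /f.
have sepP (S : {set G}) :
    S \subset P -> independent (collinear G) S -> separated 4 S.
  exact: collinear_separated.
have S2P' : S2 \subset P by apply: subset_trans S2P (subsetDl _ _).
case: (boolP (u \notin P)) => uP; case: (boolP (v \notin P)) => vP.
- by move=> _; apply: (independent_separated indC); rewrite ?inE.
- by case: ifP => // _; case: ifP.
- by case: ifP => // _; case: ifP.
case: (boolP (u \in S1)) => uS1; case: (boolP (v \in S1)) => vS1 //;
  try by case: ifP.
  by move=> _ /(sepP _ S1P ind1 _ _ _ uS1 vS1 nuv)/ltnW.
case: (boolP (u \in S2)) => uS2; case: (boolP (v \in S2)) => vS2 //.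
  by move=> _ /(sepP _ S2P' ind2 _ _ _ uS2 vS2 nuv).
move: uP vP; rewrite !negbK => uP vP [/eqP].
by rewrite (inj_in_eq (@index_inj _ _ _)) ?(negbTE nuv) // mem_enum !inE
  ?uS1 ?uS2 ?vS1 ?vS2.
Qed.

(** * Bounds on the colour classes *)

Definition colour_class (G : sgraph) k (c : {ffun G -> 'I_k}) (i : nat) :
  {set G} := [set v | c v == i :> nat].

Lemma colour_class_separated (G : sgraph) k (c : {ffun G -> 'I_k}) i :
  packing_coloring c -> separated i.+2 (colour_class c i).
Proof.
move=> pc u v n; rewrite !inE => /eqP cu /eqP cv nuv w.
move/forallP/(_ u)/forallP/(_ v): pc; rewrite nuv -val_eqE /= cu cv eqxx /=.
by rewrite /colour cu => /dist_geP; apply.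
Qed.

(* Beyond the diameter a colour is used at most once. *)
Lemma packing_card_bound (G : sgraph) d k (c : {ffun G -> 'I_k}) :
  (forall u v : G, exists2 n, n <= d.+1 & walk u v n) -> packing_coloring c ->
  #|G| <= \sum_(0 <= i < d) #|colour_class c i| + (k - d).
Proof.
move=> diam pc; pose B := [set v | d <= c v].
have -> : #|G| = #|~: B| + #|B| by rewrite addnC cardsC.
apply: leq_add.
  rewrite (@eq_card _ _ (\bigcup_(i < d) colour_class c i)) => [|v]; last first.
    rewrite !inE -ltnNge; apply/idP/bigcupP => [cvd|[i _]].
      by exists (Ordinal cvd); rewrite ?inE.
    by rewrite inE => /eqP->.
  rewrite big_mkord; elim/big_rec2: _ => [|i n A _ le]; first by rewrite cards0.
  by apply: leq_trans (leq_card_setU _ _) _; rewrite leq_add2l.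
have inj : {in B &, injective c}.
  move=> u v; rewrite !inE => du dv cuv; apply/eqP; apply: contraT => nuv.
  have [n nd w] := diam u v.
  have := colour_class_separated pc (_ : u \in colour_class c (c u))
    (_ : v \in colour_class c (c u)) nuv w.
  rewrite !inE cuv eqxx => /(_ isT isT) le.
  by move: (leq_trans le nd); rewrite ltnS ltnNge dv.
rewrite -(card_in_imset inj).
(* For [k < d] the truncated [k - d] is 0, and no vertex has index at least [d]. *)
case: (leqP d k) => [dk|kd]; last first.
  rewrite (_ : c @: B = set0) ?cards0 //; apply/setP=> i; rewrite inE.
  apply/negP=> /imsetP[v]; rewrite inE => dv _.
  by have := leq_trans (leq_ltn_trans dv (ltn_ord (c v))) (ltnW kd); rewrite ltnn.
rewrite -[X in _ <= X](size_iota d) cardE -(size_map val).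
apply: uniq_leq_size; first by rewrite map_inj_uniq ?enum_uniq //; apply: val_inj.
move=> j /mapP[i]; rewrite mem_enum => /imsetP[v + ->] ->.
by rewrite inE mem_iota subnKC // => ->; rewrite ltn_ord.
Qed.

(** Reversal sends the oriented edges leaving [S] to edges leaving its complement, and misses
    [(u, v)]. *)
Lemma independent_card_lt (G : sgraph) k (S : {set G}) (u v : G) :
  regular G k.+1 -> independent (@adj G) S -> adj u v -> u \notin S ->
  v \notin S -> 2 * #|S| < #|G|.
Proof.
move=> regG indS uv uS vS; have := cardsC S; rewrite -(ltn_pmul2r (ltn0Sn k)).
move=> <-; rewrite mulnDl -!(card_darts _ regG) mul2n -addnn mulnDl.
rewrite -!(card_darts _ regG) ltn_add2l.
pose swap (e : G * G) := (e.2, e.1).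
have swap_inj : injective swap by move=> [? ?] [? ?] [-> ->].
rewrite -(card_imset _ swap_inj); apply: proper_card.
apply/properP; split.
  apply/subsetP=> _ /imsetP[[a b] + ->]; rewrite !inE /= => /andP[aS ab].
  by rewrite adj_sym ab andbT; apply/negP=> bS; have := indS a b aS bS; rewrite ab.
exists (u, v); first by rewrite !inE /= uS uv.
by apply/negP=> /imsetP[[a b] + [_ vb]]; rewrite inE /= -vb (negbTE vS).
Qed.

(** Members of [S] have no common neighbour, so their neighbourhoods are disjoint in [T]. *)
Lemma separated_star (G : sgraph) k (S T : {set G}) :
  regular G k -> separated 3 S ->
  {in S, forall v w, adj v w -> w \in T} -> #|S| * k <= #|T|.
Proof.
move=> regG sepS ST.
apply: (@leq_card_family _ _ _ S T (fun s => enum [set w | adj s w])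
  (fun _ w => w)) => [s _|s _|s w sS|s s' w w' sS sS'].
- exact: enum_uniq.
- by rewrite -cardE.
- by rewrite mem_enum inE; apply: ST.
rewrite !mem_enum !inE => sw + eww'; rewrite -eww' adj_sym => ws'.
split=> //; apply/eqP; apply: contraT => nss'.
have := sepS _ _ 2 sS sS' nss'; rewrite walk2; apply.
by apply/existsP; exists w; rewrite sw.
Qed.

(** Classes 1 and 2 are bounded together, because the gain of 1 in [a12.+1] may come from either. *)
Lemma moore12_packing_bounds (G : sgraph) q k (N := \sum_(0 <= i < 6) q ^ i) :
  regular G q.+1 -> girth_ge G 12 -> #|G| = 2 * N -> 0 < q ->
  packing_colorable G k ->
  exists a12 a3 a4 a5,
    [/\ 2 * N <= a12 + a3 + a4 + a5 + (k - 5),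
        (q + 2) * a12.+1 <= (q + 4) * N,
        (q + 1) * a3 <= N,
        (q ^ 2 + 2 * q + 2) * a4 <= 2 * N
      & (q ^ 2 + q + 1) * a5 <= N].
Proof.
move=> regG gG nG q_gt0 /existsP[c pc].
have diam (u v : G) : exists2 n, n <= 6 & walk u v n.
  exact: moore12_diameter regG gG nG.
have := packing_card_bound diam pc.
have sep i : separated i.+2 (colour_class c i) by exact: colour_class_separated.
have girth_le g : g <= 12 -> girth_ge G g by move=> g12 C /gG; apply: leq_trans.
rewrite 5?big_nat_recr //= big_geq // add0n nG.
set a1 := #|colour_class c 0|; set a2 := #|colour_class c 1|.
set a3 := #|colour_class c 2|; set a4 := #|colour_class c 3|.
set a5 := #|colour_class c 4| => le_n.
have := separated_edge_ball (r := 0) regG (girth_le 3 isT) (sep 0).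
have := separated_ball (r := 1) regG (girth_le 3 isT) (sep 1).
have := separated_edge_ball (r := 1) regG (girth_le 5 isT) (sep 2).
have := separated_ball (r := 2) regG (girth_le 5 isT) (sep 3).
have := separated_edge_ball (r := 2) regG (girth_le 7 isT) (sep 4).
rewrite !big_nat_recr //= !big_geq // !expn0 expn1 !add0n nG.
rewrite -/a1 -/a2 -/a3 -/a4 -/a5 => b5 b4 b3 b2 b1.
exists (a1 + a2), a3, a4, a5; split=> //; last 3 first.
- by lia.
- by lia.
- by lia.
(* If all neighbours of class 2 have colour 1, stars give [a2 <= N / (q+1)], about half the ball
   bound. Otherwise some edge misses class 1 and [a1 < N]. *)
have [cover|] := boolP [forall v in colour_class c 1, forall w,
   adj v w ==> (w \in colour_class c 0)].
  have: a2 * q.+1 <= a1.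
    apply: separated_star regG (sep 1) _ => v vS w vw.
    by move: cover => /forall_inP/(_ v vS)/forallP/(_ w)/implyP; apply.
  have NE : N = q.+1 * (q ^ 4 + q ^ 2 + 1).
    by rewrite /N !big_nat_recr //= big_geq //; ring.
  move=> le2; have M_gt0 : 0 < q ^ 4 by rewrite expn_gt0 q_gt0.
  have le2M : a2 <= q ^ 4 + q ^ 2 + 1.
    by rewrite -(leq_pmul2l (ltn0Sn q)) -NE; lia.
  have : q.+1 * 3 <= N by rewrite NE leq_mul2l /=; lia.
  have : q * 3 <= q * (q ^ 4 + q ^ 2 + 1).
    by rewrite leq_mul2l; apply/orP; right; lia.
  have : (q + 2) * a1 <= (q + 2) * N by rewrite leq_mul2l; apply/orP; right; lia.
  by lia.
rewrite negb_forall_in => /exists_inP[v v1]; rewrite negb_forall.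
case/existsP=> w; rewrite negb_imply => /andP[vw w0].
have v0 : v \notin colour_class c 0.
  by move: v1; rewrite !inE => /eqP->.
have ind0 : independent (@adj G) (colour_class c 0).
  move=> x y x0 y0; apply/negP=> xy.
  have nxy : x != y by apply/eqP=> exy; rewrite exy adj_irr in xy.
  by have := sep 0 x y 1 x0 y0 nxy; rewrite walk1 => /(_ xy).
have := independent_card_lt regG ind0 vw v0 w0; rewrite nG -/a1 => lt1.
have : (q + 2) * a1.+1 <= (q + 2) * N by rewrite leq_mul2l; apply/orP; right; lia.
by lia.
Qed.

(** * Numerical form of the two bounds *)

Lemma moore12_card (G : sgraph) q :
  1 < q -> (#|G|%:R = moore_bound (q + 1) 12 :> rat)%R ->
  #|G| = 2 * \sum_(0 <= i < 6) q ^ i.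
Proof.
move=> q1 nG; apply/eqP; rewrite -(eqr_nat rat) nG /moore_bound.
rewrite !big_nat_recr //= big_geq // add0n.
rewrite !(natrM, natrD, natrX) -(ltr_nat rat) in q1 *.
by apply/eqP; field; lra.
Qed.

Lemma moore12_packing_upper (G : sgraph) q :
  regular G q.+1 -> girth_ge G 12 -> #|G| = 2 * \sum_(0 <= i < 6) q ^ i ->
  odd q -> 9 <= q ->
  packing_chromatic G + 2 * q ^ 3 + q ^ 2 <= q ^ 5 + q ^ 4 + 4.
Proof.
move=> regG gG nG q_odd q9.
have nE : \sum_(0 <= i < 6) q ^ i = q ^ 5 + q ^ 4 + q ^ 3 + q ^ 2 + q + 1.
  by rewrite !big_nat_recr //= big_geq //; ring.
(* These comparisons make the polynomial inequalities linear in the powers of [q]. *)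
have pow i : 9 * q ^ i <= q ^ i.+1 by rewrite expnS leq_mul2r q9 orbT.
have n_gt0 : 0 < #|G| by rewrite nG nE addn1.
have [P [indP indC cardP]] := moore12_bipartition regG gG nG n_gt0.
have g7 : girth_ge G 7 by move=> C /gG; apply: leq_trans.
(* Chosen so that [N - 2t + 3] is exactly the claimed bound; the sum is even because [q] is odd. *)
pose t := (3 * q ^ 3 + 2 * q ^ 2 + q)./2.
have tE : 2 * t = 3 * q ^ 3 + 2 * q ^ 2 + q.
  by rewrite mul2n even_halfK // !(oddD, oddM, oddX) q_odd.
(* The second set is sought in [P] without the first, whence [#|P| - t]. *)
have t_le : t * (q ^ 2 + 2 * q + 2) <= 2 * (#|P| - t).
  rewrite cardP nE.
  suff : 2 * t * (q ^ 2 + 2 * q + 4) <=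
      4 * (q ^ 5 + q ^ 4 + q ^ 3 + q ^ 2 + q + 1) by lia.
  by rewrite tE; move: (pow 1) (pow 2) (pow 3) (pow 4); lia.
have [|S1 [S1P ind1 card1]] :=
  @collinear_independent_card G q P t regG g7.
  by apply: leq_trans t_le _; rewrite leq_mul2l leq_subr.
have [|S2 [S2P ind2 card2]] :=
  @collinear_independent_card G q (P :\: S1) t regG g7.
  by rewrite cardsD (setIidPr S1P) card1.
have := packing_chromatic_leq indP indC S1P S2P ind1 ind2.
rewrite card1 card2 cardP nE.
by move: (pow 1) (pow 2) (pow 3) (pow 4); lia.
Qed.

Lemma moore12_packing_lower (G : sgraph) q (x := (q%:R)%R : rat) :
  regular G q.+1 -> girth_ge G 12 -> #|G| = 2 * \sum_(0 <= i < 6) q ^ i ->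
  9 <= q ->
  (x ^+ 5 - 2 * x ^+ 4 - 4 * x ^+ 2 + 9 * x - 18 + 42 / (x + 2)
     <= (packing_chromatic G)%:R)%R.
Proof.
move=> regG gG nG q9; rewrite /packing_chromatic; case: ex_minnP => k col _.
have [a12 [a3 [a4 [a5 [le_n le12 le3 le4 le5]]]]] :=
  moore12_packing_bounds regG gG nG (leq_trans (isT : 0 < 9) q9) col.
move: le_n le12 le3 le4 le5.
have -> : \sum_(0 <= i < 6) q ^ i = q ^ 5 + q ^ 4 + q ^ 3 + q ^ 2 + q + 1.
  by rewrite !big_nat_recr //= big_geq //; ring.
move=> le_n le12 le3 le4 le5.
(* [N] factors both as [(q+1)(q^4+q^2+1)] and as [(q^2+q+1)(q^3+1)]. *)
have {}le3 : a3 <= q ^ 4 + q ^ 2 + 1.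
  by rewrite -(leq_pmul2l (_ : 0 < q + 1)) ?addn1 //; lia.
have {}le5 : a5 <= q ^ 3 + 1.
  by rewrite -(leq_pmul2l (_ : 0 < q ^ 2 + q + 1)) ?addn1 //; lia.
(* The integer part of [2N / (q^2+2q+2)], with its negative term moved to the left. *)
have {}le4 : a4 + 2 * q ^ 2 <= 2 * q ^ 3 + 2 * q + 1.
  have : (q ^ 2 + 2 * q + 2) * (a4 + 2 * q ^ 2) <
         (q ^ 2 + 2 * q + 2) * (2 * q ^ 3 + 2 * q + 2) by lia.
  by rewrite ltn_mul2l => /andP[_]; lia.
have x9 : (9 <= x)%R by rewrite (ler_nat rat 9).
have xE : (q%:R = x)%R by [].
clearbody x; set y : rat := (42 / (x + 2))%R.
have x2 : (0 < x + 2)%R by lra.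
have y0 : (0 <= y)%R by rewrite divr_ge0 // ltW.
(* Here [(q+4)N / (q+2) = N + 2N / (q+2)]; dividing [N] by [q+2] leaves remainder -21, the source of
   42. *)
have {}le12 : (a12%:R + 1 <= x ^+ 5 + x ^+ 4 + x ^+ 3 + x ^+ 2 + x + 1
    + 2 * (x ^+ 4 - x ^+ 3 + 3 * x ^+ 2 - 5 * x + 11) - y)%R.
  rewrite -(ler_pM2l x2).
  have -> : ((x + 2) * (x ^+ 5 + x ^+ 4 + x ^+ 3 + x ^+ 2 + x + 1
    + 2 * (x ^+ 4 - x ^+ 3 + 3 * x ^+ 2 - 5 * x + 11) - y) =
    (x + 4) * (x ^+ 5 + x ^+ 4 + x ^+ 3 + x ^+ 2 + x + 1))%R.
    by rewrite /y; field; rewrite gt_eqF.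
  move: le12; rewrite -(ler_nat rat) -[a12.+1]addn1.
  by rewrite !(natrM, natrD, natrX) xE.
move: le_n le3 le4 le5; rewrite -!(ler_nat rat).
rewrite !(natrM, natrD, natrX) xE => le_n le3 le4 le5.
have le_k : (x ^+ 5 - 2 * x ^+ 4 - 4 * x ^+ 2 + 9 * x - 18 + y
    <= (k - 5)%:R + 5)%R by lra.
(* For [k < 5] the truncated [k - 5] is 0 and the left side would be at most 5, impossible for
   [x >= 9]. *)
have k_ge5 : 5 <= k.
  rewrite leqNgt; apply/negP=> k5; move: le_k.
  have -> : k - 5 = 0 by lia.
  have pow i : (9 * x ^+ i <= x ^+ i.+1)%R.
    by rewrite exprS ler_wpM2r // exprn_ge0 //; lra.
  by move: (pow 1) (pow 2) (pow 3) (pow 4); rewrite expr1; lra.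
by move: le_k; rewrite natrB //; lra.
Qed.

Local Open Scope ring_scope.

Theorem theorem3p3 (q : nat) (G : sgraph)
    (q_odd : odd q) (q_pp : prime_power q) (q_ge9 : (9 <= q)%N)
    (G_moore : moore_graph (q + 1) 12 G) :
  let x : rat := q%:R in
  x ^+ 5 - 2 * x ^+ 4 - 4 * x ^+ 2 + 9 * x - 18 + 42 / (x + 2)
    <= (packing_chromatic G)%:R
    <= x ^+ 5 + x ^+ 4 - 2 * x ^+ 3 - x ^+ 2 + 4.
Proof.
cbv zeta; set x : rat := q%:R; case: G_moore => _ _ [regG [_ gG]] card_rat.
have nG := moore12_card (leq_trans (isT : (1 < 9)%N) q_ge9) card_rat.
rewrite addn1 in regG; rewrite moore12_packing_lower //=.
have := moore12_packing_upper regG gG nG q_odd q_ge9.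
by rewrite -(ler_nat rat) !(natrM, natrD, natrX) -/x; lra.
Qed.
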